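(* Let $p$ be a prime number. The category $\mathfrak{s}_p$, whose single object is $\overline{\mathbb{N}}$ and whose morphisms are the maps $\overline{\mathbb{N}}\to\overline{\mathbb{N}}$, $x\mapsto p^k x$, for $k\in\mathbb{N}$ (including $k=0$), is a (Cuntz) Fraïssé category, and its Fraïssé limit is the $\mathrm{Cu}$-semigroup $S_p=\mathbb{N}[\tfrac1p]\sqcup(0,\infty]$.
   Context: **$\mathrm{Cu}$-semigroups.** For $x,y$ in a partially ordered set, $x\ll y$ means: for every increasing sequence $(z_n)_n$ having a supremum with $y\le\sup_n z_n$, there is $n$ with $x\le z_n$. A $\mathrm{Cu}$-semigroup is a positively ordered (commutative) monoid $S$ such that (O1) every increasing sequence has a supremum; (O2) every element is the supremum of a $\ll$-increasing sequence; (O3) $x'\ll x$ and $y'\ll y$ imply $x'+y'\ll x+y$; (O4) $\sup_n(x_n+y_n)=\sup_n x_n+\sup_n y_n$ for increasing sequences. A $\mathrm{Cu}$-morphism is a monoid morphism preserving the order, the relation $\ll$, and suprema of increasing sequences. $\mathrm{Cu}$ denotes the resulting category; it has inductive limits. $S$ is countably-based if there is a countable subset $B\subseteq S$ such that every element of $S$ is the supremum of a $\ll$-increasing sequence in $B$. $\overline{\mathbb{N}}=\{0,1,2,\ldots,\infty\}$ with usual order and addition. **The semigroup $S_p$.** $\mathbb{N}[\frac1p]=\{k/p^l:k,l\in\mathbb{N}\}$. $S_p$ is the disjoint union $\mathbb{N}[\frac1p]\sqcup(0,\infty]$. Write $x_c$ for elements of $\mathbb{N}[\frac1p]$ and $y_s$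 for elements of $(0,\infty]$. On each of the two parts, addition and order are the usual ones; mixed sums are $x_c+y_s=(x+y)_s$; the mixed order is: $y_s\le x_c$ iff $y\le x$, and $x_c\le y_s$ iff $x<y$. **Finite-set comparison.** For $\mathrm{Cu}$-morphisms $\alpha,\beta\colon S\to T$ and a finite set $F\subseteq S$, write $\alpha\simeq_F\beta$ if $\alpha(x')\le\beta(x)$ and $\beta(x')\le\alpha(x)$ for all $x',x\in F$ with $x'\ll x$. **Fraïssé categories.** A subcategory $\mathfrak{c}$ of $\mathrm{Cu}$ is a (Cuntz) Fraïssé category if: - (JEP) for any $A_1,A_2\in\mathfrak{c}$ there is $B\in\mathfrak{c}$ with $\mathrm{Hom}_{\mathfrak{c}}(A_1,B)$ and $\mathrm{Hom}_{\mathfrak{c}}(A_2,B)$ nonempty; - (NAP) for any $\mathfrak{c}$-morphisms $\alpha_1\colon A\to B_1$, $\alpha_2\colon A\to B_2$ and any finite $F\subseteq A$, there are $C\in\mathfrak{c}$ and $\mathfrak{c}$-morphisms $\beta_1\colon B_1\to C$, $\beta_2\colon B_2\to C$ with $\beta_1\circ\alpha_1\simeq_F\beta_2\circ\alpha_2$; - (SEP) there is a subcategory $\mathfrak{s}\subseteq\mathfrak{c}$ whose objects are countably-based, whose set of morphisms is countable, such that every $A\in\mathfrak{c}$ admits a $\mathfrak{c}$-morphism to some $S\in\mathfrak{s}$, and such that for any $\mathfrak{c}$-morphism $\sigma\colon S\to A$ with $S\in\mathfrak{s}$ and any finite $F\subseteq S$ there are $T\in\mathfrak{s}$, $\alpha\in\mathrm{Hom}_{\mathfrak{c}}(A,T)$,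 $\tau\in\mathrm{Hom}_{\mathfrak{s}}(S,T)$ with $\alpha\circ\sigma\simeq_F\tau$. **Fraïssé sequences and limits.** An inductive sequence $(S_i,\sigma_{i,j})_{i\in\mathbb{N}}$ in $\mathfrak{c}$ is a Fraïssé sequence if every $S_i$ is countably-based and, for every $i$, every finite $F\subseteq S_i$ and every $\mathfrak{c}$-morphism $\alpha\colon S_i\to C$, there are $j\ge i$ and a $\mathfrak{c}$-morphism $\beta_F\colon C\to S_j$ with $\beta_F\circ\alpha\simeq_F\sigma_{i,j}$. The Fraïssé limit of a Fraïssé category is the $\mathrm{Cu}$-limit of any of its Fraïssé sequences (such a sequence exists, and its limit is unique up to isomorphism). *)

(* Defs.v *)
From HB Require Import structures.
From mathcomp Require Import all_boot all_order all_algebra.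
From mathcomp Require Import boolp classical_sets functions cardinality.
From mathcomp Require Import reals ereal topology normedtype sequences.

Set Implicit Arguments.
Unset Strict Implicit.
Unset Printing Implicit Defensive.

Import Order.TTheory GRing.Theory Num.Theory.
Local Open Scope classical_set_scope.
Local Open Scope order_scope.

Definition is_sup (d : Order.disp_t) (T : porderType d) (z : nat -> T) (s : T) :
  Prop := isLub (range z) s.

Definition way_below (d : Order.disp_t) (T : porderType d) (x y : T) : Prop :=
  forall (z : nat -> T) (s : T),
    nondecreasing_seq z -> is_sup z s -> (y <= s)%O -> exists n, (x <= z n)%O.

Notation "x ≪ y" := (way_below x y) (at level 70, no associativity).

Definition way_increasing (d : Order.disp_t) (T : porderType d) (z : nat -> T) :
  Prop := forall n, z n ≪ z n.+1.

(* The operations are fields rather than an [nmodType] structure because the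
   library's only join of an order with an additive structure has opposites. *)
HB.mixin Record isPOMonoid (d : Order.disp_t) S of Order.POrder d S := {
  cu_zero : S;
  cu_add : S -> S -> S;
  cu_addA : associative cu_add;
  cu_addC : commutative cu_add;
  cu_add0 : left_id cu_zero cu_add;
  cu_ge0 : forall x : S, cu_zero <= x;
  cu_leD : forall x y x' y' : S, x <= x' -> y <= y' -> cu_add x y <= cu_add x' y'
}.

#[short(type="poMonoidType")]
HB.structure Definition POMonoid (d : Order.disp_t) :=
  {S of Order.POrder d S & isPOMonoid d S}.

Declare Scope cu_scope.
Delimit Scope cu_scope with cu.
Notation "0" := cu_zero : cu_scope.
Notation "x + y" := (cu_add x y) : cu_scope.
Notation "x *+ n" := (iter n (cu_add x) cu_zero) : cu_scope.
Local Open Scope cu_scope.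

Fact cu_display : Order.disp_t. Proof. exact. Qed.

HB.mixin Record isCuSemigroup S of POMonoid cu_display S := {
  cu_O1 : forall z : nat -> S, nondecreasing_seq z -> exists s, is_sup z s;
  cu_O2 : forall x : S, exists2 z : nat -> S, way_increasing z & is_sup z x;
  cu_O3 : forall x' x y' y : S, x' ≪ x -> y' ≪ y -> x' + y' ≪ x + y;
  cu_O4 : forall (x y : nat -> S) (s t : S),
    nondecreasing_seq x -> nondecreasing_seq y ->
    is_sup x s -> is_sup y t -> is_sup (fun n => x n + y n) (s + t)
}.

#[short(type="cuType")]
HB.structure Definition Cu := {S of POMonoid cu_display S & isCuSemigroup S}.

Definition cu_morphism (S T : cuType) (f : S -> T) : Prop :=
  [/\ f 0 = 0,
      {morph f : x y / x + y},
      {homo f : x y / x <= y},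
      {homo f : x y / x ≪ y} &
      forall (z : nat -> S) (s : S),
        nondecreasing_seq z -> is_sup z s -> is_sup (f \o z) (f s)].

Definition countably_based (S : cuType) : Prop :=
  exists2 B : set S, countable B &
    forall x : S, exists z : nat -> S,
      [/\ forall n, B (z n), way_increasing z & is_sup z x].

Definition approx_on (S T : cuType) (F : set S) (f g : S -> T) : Prop :=
  forall x' x : S, F x' -> F x -> x' ≪ x -> f x' <= g x /\ g x' <= f x.

Record subcategory := Subcategory {
  ob : set cuType;
  hom : forall S T : cuType, set (S -> T);
  hom_cu : forall (S T : cuType) (f : S -> T), hom f -> cu_morphism f;
  hom_ob : forall (S T : cuType) (f : S -> T), hom f -> ob S /\ ob T;
  hom_id : forall S : cuType, ob S -> hom (@idfun S);
  hom_comp : forall (S T U : cuType) (f : S -> T) (g : T -> U),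
    hom f -> hom g -> hom (g \o f)
}.

Definition is_subcategory_of (s c : subcategory) : Prop :=
  ob s `<=` ob c /\ forall S T : cuType, @hom s S T `<=` @hom c S T.

Definition morphisms (c : subcategory) :
    set {S : cuType & {T : cuType & S -> T}} :=
  [set m | hom c (projT2 (projT2 m))].

Definition joint_embedding (c : subcategory) : Prop :=
  forall A1 A2 : cuType, ob c A1 -> ob c A2 ->
    exists B : cuType,
      [/\ ob c B, @hom c A1 B !=set0 & @hom c A2 B !=set0].

Definition near_amalgamation (c : subcategory) : Prop :=
  forall (A B1 B2 : cuType) (f1 : A -> B1) (f2 : A -> B2) (F : set A),
    hom c f1 -> hom c f2 -> finite_set F ->
    exists (C : cuType) (g1 : B1 -> C) (g2 : B2 -> C),
      [/\ ob c C, hom c g1, hom c g2 & approx_on F (g1 \o f1) (g2 \o f2)].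

Definition separability (c : subcategory) : Prop :=
  exists s : subcategory,
    [/\ is_subcategory_of s c,
        forall S : cuType, ob s S -> countably_based S,
        countable (morphisms s),
        forall A : cuType, ob c A ->
          exists2 S : cuType, ob s S & @hom c A S !=set0 &
        forall (S A : cuType) (f : S -> A) (F : set S),
          ob s S -> hom c f -> finite_set F ->
          exists (T : cuType) (g : A -> T) (h : S -> T),
            [/\ ob s T, hom c g, hom s h & approx_on F (g \o f) h]].

Definition fraisse_category (c : subcategory) : Prop :=
  [/\ joint_embedding c, near_amalgamation c & separability c].

(* The bonding map [bond i j] is meaningful only for [i <= j]. *)
Definition inductive_sequence (c : subcategory)
    (S : nat -> cuType) (bond : forall i j, S i -> S j) : Prop :=
  [/\ forall i, ob c (S i),
      forall i j, (i <= j)%N -> hom c (bond i j),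
      forall i, bond i i = idfun &
      forall i j k, (i <= j <= k)%N -> bond j k \o bond i j = bond i k].

Definition fraisse_sequence (c : subcategory)
    (S : nat -> cuType) (bond : forall i j, S i -> S j) : Prop :=
  [/\ inductive_sequence c bond,
      forall i, countably_based (S i) &
      forall i (F : set (S i)) (C : cuType) (f : S i -> C),
        finite_set F -> hom c f ->
        exists j, (i <= j)%N /\
          exists2 g : C -> S j, hom c g & approx_on F (g \o f) (bond i j)].

Definition cu_cocone (S : nat -> cuType) (bond : forall i j, S i -> S j)
    (L : cuType) (phi : forall i, S i -> L) : Prop :=
  (forall i, cu_morphism (phi i)) /\
  (forall i j, (i <= j)%N -> phi j \o bond i j = phi i).

Definition cu_limit (S : nat -> cuType) (bond : forall i j, S i -> S j)
    (L : cuType) (phi : forall i, S i -> L) : Prop :=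
  cu_cocone bond phi /\
  forall (T : cuType) (psi : forall i, S i -> T), cu_cocone bond psi ->
    exists! u : L -> T, cu_morphism u /\ forall i, u \o phi i = psi i.

(* The existence clause keeps the universal clause from being vacuous. *)
Definition is_fraisse_limit (c : subcategory) (L : cuType) : Prop :=
  (exists (S : nat -> cuType) (bond : forall i j, S i -> S j),
     fraisse_sequence c bond) /\
  (forall (S : nat -> cuType) (bond : forall i j, S i -> S j),
     fraisse_sequence c bond ->
     exists phi : forall i, S i -> L, cu_limit bond phi).

Section IsSup.
Variables (d : Order.disp_t) (T : porderType d).
Implicit Types (z : nat -> T) (s t x y : T).

Lemma is_sup_ub z s n : is_sup z s -> z n <= s.
Proof. by case=> + _; apply; exists n. Qed.

Lemma is_sup_lub z s t : is_sup z s -> (forall n, z n <= t) -> s <= t.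
Proof. by case=> _ + zt; apply => _ [n _ <-]. Qed.

Lemma is_supP z s :
  (forall n, z n <= s) -> (forall t, (forall n, z n <= t) -> s <= t) ->
  is_sup z s.
Proof.
move=> ub lub; split=> [_ [n _ <-]//|t zt].
by apply: lub => n; apply: zt; exists n.
Qed.

Lemma is_sup_max z n : (forall m, z m <= z n) -> is_sup z (z n).
Proof. by move=> zn; apply: is_supP. Qed.

Lemma is_sup_unique z s t : is_sup z s -> is_sup z t -> s = t.
Proof.
move=> zs zt; apply/le_anti/andP; split.
  by apply: (is_sup_lub zs) => n; exact: is_sup_ub.
by apply: (is_sup_lub zt) => n; exact: is_sup_ub.
Qed.

Lemma way_below_le x y : x ≪ y -> x <= y.
Proof. by move=> /(_ (fun=> y) y)[||//|//]; [move=> ? ? _|exact: is_sup_max 0%N _]. Qed.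

End IsSup.

Section MulN.
Variable S : cuType.

Lemma cu_mulnDl n : {morph (fun x : S => x *+ n) : x y / x + y}.
Proof.
move=> x y; elim: n => [|n IHn] /=; first by rewrite cu_add0.
by rewrite IHn !cu_addA; congr cu_add; rewrite -!cu_addA; congr cu_add; rewrite cu_addC.
Qed.

Lemma cu_muln0 n : (0 : S) *+ n = 0.
Proof. by elim: n => //= n ->; rewrite cu_add0. Qed.

Lemma cu_leMn n : {homo (fun x : S => x *+ n) : x y / x <= y}.
Proof. by move=> x y xy; elim: n => //= n IHn; exact: cu_leD. Qed.

Lemma cu_muln_morphism n : cu_morphism (fun x : S => x *+ n).
Proof.
split; [exact: cu_muln0|exact: cu_mulnDl|exact: cu_leMn| |].
  move=> x y xy; elim: n => /= [|n IHn]; last exact: cu_O3.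
  by move=> z s _ _ _; exists 0%N; exact: cu_ge0.
move=> z s zi zs; elim: n => /= [|n IHn]; first exact: is_sup_max 0%N _.
by apply: cu_O4 => // i j ij /=; apply: cu_leMn; exact: zi.
Qed.

Lemma cu_mulnDr (x : S) m n : x *+ (m + n)%N = x *+ m + x *+ n.
Proof. by elim: m => [|m IHm]; rewrite ?cu_add0 //= IHm cu_addA. Qed.

Lemma cu_mulnA (x : S) m n : x *+ (m * n)%N = x *+ n *+ m.
Proof. by elim: m => //= m IHm; rewrite mulSn cu_mulnDr IHm. Qed.

End MulN.

Variant natbar := NFin of nat | NInf.

Definition natbar_option (x : natbar) : option nat :=
  if x is NFin n then Some n else None.
Definition option_natbar (x : option nat) : natbar :=
  if x is Some n then NFin n else NInf.
Lemma natbar_optionK : cancel natbar_option option_natbar. Proof. by case. Qed.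
HB.instance Definition _ := Choice.copy natbar (can_type natbar_optionK).

Definition natbar_le (x y : natbar) : bool :=
  match x, y with
  | NFin m, NFin n => (m <= n)%N
  | _, NInf => true
  | NInf, NFin _ => false
  end.

Definition natbar_add (x y : natbar) : natbar :=
  match x, y with NFin m, NFin n => NFin (m + n)%N | _, _ => NInf end.

Lemma natbar_le_refl : reflexive natbar_le.
Proof. by case=> [m|] /=. Qed.
Lemma natbar_le_anti : antisymmetric natbar_le.
Proof. by case=> [m|] [n|] //= /anti_leq ->. Qed.
Lemma natbar_le_trans : transitive natbar_le.
Proof. by case=> [m|] [n|] [k|] //=; exact: leq_trans. Qed.

HB.instance Definition _ := Order.Le_isPOrder.Build cu_display natbar
  natbar_le_refl natbar_le_anti natbar_le_trans.

Lemma natbar_addA : associative natbar_add.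
Proof. by case=> [m|] [n|] [k|] //=; rewrite addnA. Qed.
Lemma natbar_addC : commutative natbar_add.
Proof. by case=> [m|] [n|] //=; rewrite addnC. Qed.
Lemma natbar_add0 : left_id (NFin 0) natbar_add.
Proof. by case. Qed.
Lemma natbar_ge0 (x : natbar) : NFin 0 <= x.
Proof. by case: x. Qed.
Lemma natbar_leD (x y x' y' : natbar) :
  x <= x' -> y <= y' -> natbar_add x y <= natbar_add x' y'.
Proof.
by move: x y x' y' => [m|] [n|] [m'|] [n'|] //; exact: leq_add.
Qed.

HB.instance Definition _ := isPOMonoid.Build cu_display natbar
  natbar_addA natbar_addC natbar_add0 natbar_ge0 natbar_leD.

Lemma natbar_sup_cases (z : nat -> natbar) : nondecreasing_seq z ->
  (exists n, forall m, z m <= z n) \/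
  (is_sup z NInf /\ forall k, exists n, NFin k <= z n).
Proof.
move=> zi; have [|nomax] := pselect (exists n, forall m, z m <= z n); first by left.
have unb k : exists n, NFin k <= z n.
  elim: k => [|k [n kn]]; first by exists 0%N; exact: natbar_ge0.
  have [m zmn] : exists m, ~ z m <= z n.
    by apply/existsNP => zn; apply: nomax; exists n.
  exists m; move: kn zmn; case: (z n) (z m) => [a|] [b|] // ka /negP.
  by rewrite -ltnNge; exact: leq_ltn_trans.
right; split=> //; apply: is_supP => [n|[m|//] zm]; first by case: (z n).
have [n /le_trans/(_ (zm n))] := unb m.+1.
by rewrite /Order.le /= ltnn.
Qed.

Lemma natbar_way_below (x y : natbar) : x ≪ y <-> x <= y /\ x <> NInf.
Proof.
split=> [xy|[xy xfin]].
  split; first exact: way_below_le.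
  move=> xE; have {xy} := xy (fun n => NFin n) NInf.
  case=> [m n|||n]; first by [].
  - apply: is_supP => [//|[m|//] /(_ m.+1)].
    by rewrite /Order.le /= ltnn.
  - by case: (y).
  - by rewrite xE.
move: x xy xfin => [m|//] my _ z s zi zs ys.
have [[n zn]|[_ unb]] := natbar_sup_cases zi; last exact: unb.
by exists n; rewrite (is_sup_unique (is_sup_max zn) zs) (le_trans my).
Qed.

Lemma natbar_O1 (z : nat -> natbar) :
  nondecreasing_seq z -> exists s, is_sup z s.
Proof.
move=> /natbar_sup_cases[[n /is_sup_max zn]|[? _]]; last by exists NInf.
by exists (z n).
Qed.

Lemma natbar_O2 (x : natbar) :
  exists2 z : nat -> natbar, way_increasing z & is_sup z x.
Proof.
case: x => [m|].
  exists (fun=> NFin m); last exact: is_sup_max 0%N _.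
  by move=> n; apply/natbar_way_below.
exists NFin => [n|]; first by apply/natbar_way_below; split=> //; exact: leqnSn.
apply: is_supP => [//|[m|//] /(_ m.+1)].
by rewrite /Order.le /= ltnn.
Qed.

Lemma natbar_O3 (x' x y' y : natbar) : x' ≪ x -> y' ≪ y -> x' + y' ≪ x + y.
Proof.
move=> /natbar_way_below[xx xf] /natbar_way_below[yy yf].
apply/natbar_way_below; split; first exact: natbar_leD.
by move: xf yf; case: (x') (y') => [?|] [?|].
Qed.

Lemma natbar_le_addr (x y : natbar) : x <= x + y.
Proof. by case: x y => [m|] [n|] //; exact: leq_addr. Qed.

Lemma natbar_O4 (x y : nat -> natbar) (s t : natbar) :
  nondecreasing_seq x -> nondecreasing_seq y ->
  is_sup x s -> is_sup y t -> is_sup (fun n => x n + y n) (s + t).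
Proof.
move=> xi yi xs yt; apply: is_supP => [n|u ub].
  by apply: natbar_leD; exact: is_sup_ub.
case: u ub => [m|] ub; last by case: (s + t).
have absurd (z : nat -> natbar) : (forall n, z n <= NFin m) ->
    ~ forall k, exists n, NFin k <= z n.
  move=> zm /(_ m.+1)[n /le_trans/(_ (zm n))].
  by rewrite /Order.le /= ltnn.
have [[n xn]|[_ /absurd[]]] := natbar_sup_cases xi; last first.
  by move=> n; exact: le_trans (natbar_le_addr _ (y n)) (ub n).
have [[k yk]|[_ /absurd[]]] := natbar_sup_cases yi; last first.
  move=> i; apply: le_trans (ub i).
  by rewrite [_ + _]natbar_addC; exact: natbar_le_addr.
rewrite (is_sup_unique xs (is_sup_max xn)) (is_sup_unique yt (is_sup_max yk)).
apply: le_trans (ub (maxn n k)).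
by apply: natbar_leD; [apply/xi/leq_maxl|apply/yi/leq_maxr].
Qed.

HB.instance Definition _ := isCuSemigroup.Build natbar
  natbar_O1 natbar_O2 natbar_O3 natbar_O4.

(* An inductive family, so that there are no morphisms unless both ends are
   [natbar]; [x *+ n] is the n-fold sum, with [NInf *+ 0 = 0]. *)
Variant pow_hom (p : nat) : forall S T : cuType, (S -> T) -> Prop :=
  PowHom (k : nat) : @pow_hom p natbar natbar (fun x => x *+ (p ^ k)%N).

Definition pow_ob : set cuType := [set natbar : cuType].

Lemma pow_hom_cu p (S T : cuType) (f : S -> T) : pow_hom p f -> cu_morphism f.
Proof. by case=> k; exact: cu_muln_morphism. Qed.

Lemma pow_hom_ob p (S T : cuType) (f : S -> T) :
  pow_hom p f -> pow_ob S /\ pow_ob T.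
Proof. by case=> k. Qed.

Lemma pow_hom_id p (S : cuType) : pow_ob S -> pow_hom p (@idfun S).
Proof.
move=> ->; rewrite (_ : idfun = fun x : natbar => x *+ (p ^ 0)%N).
  exact: PowHom.
by apply/funext => x; rewrite expn0 /= cu_addC cu_add0.
Qed.

Lemma pow_hom_comp p (S T U : cuType) (f : S -> T) (g : T -> U) :
  pow_hom p f -> pow_hom p g -> pow_hom p (g \o f).
Proof.
move=> hf; case: hf g => k g hg.
suff H (A : cuType) (h : A -> U) (e : (natbar : cuType) = A) : pow_hom p h ->
    pow_hom p (h \o eq_rect _ (fun B : cuType => natbar -> B)
                 (fun x : natbar => x *+ (p ^ k)%N) A e).
  exact: (H _ _ erefl hg).
move=> hh; case: hh e => l e; rewrite (Prop_irrelevance e erefl) /=.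
rewrite (_ : _ \o _ = fun x : natbar => x *+ (p ^ (l + k))%N).
  exact: PowHom.
by apply/funext => x; rewrite expnD cu_mulnA.
Qed.

Definition pow_category (p : nat) : subcategory :=
  Subcategory (@pow_hom_cu p) (@pow_hom_ob p) (@pow_hom_id p) (@pow_hom_comp p).

Section Sp.
Variables (R : realType) (p : nat).

Definition Ninv (x : R) : bool :=
  `[< exists k l : nat, x = (k%:R / p%:R ^+ l)%R >].

(* [inl x] is the element x_c and [inr y] is the element y_s. *)
Definition Sp : Type := ({x : R | Ninv x} + {y : \bar R | (0 < y)%E})%type.

HB.instance Definition _ := Choice.on Sp.

Lemma Ninv0 : Ninv 0%R.
Proof. by apply/asboolP; exists 0%N, 0%N; rewrite mul0r. Qed.

Lemma Ninv_ge0 x : Ninv x -> (0 <= x)%R.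
Proof. by move=> /asboolP[k [l ->]]; rewrite divr_ge0 // exprn_ge0. Qed.

Lemma NinvD x y : Ninv x -> Ninv y -> Ninv (x + y)%R.
Proof.
move=> /asboolP[k [l ->]] /asboolP[m [n ->]]; apply/asboolP.
have [p0|p0] := eqVneq (p%:R : R)%R 0%R.
  have H (a b : nat) :
      (a%:R / (0 : R) ^+ b = (if b is 0 then a else 0)%:R)%R.
    by case: b => [|b]; rewrite ?expr0 ?divr1 // expr0n invr0 mulr0.
  exists ((if l is 0 then k else 0) + (if n is 0 then m else 0))%N, 0%N.
  by rewrite p0 !H natrD.
exists (k * p ^ n + m * p ^ l)%N, (l + n)%N.
rewrite exprD natrD !natrM !natrX mulrDl; congr (_ + _)%R.
  by rewrite -mulf_div divff ?expf_neq0 // mulr1.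
by rewrite [X in (_ = _ / X)%R]mulrC -mulf_div divff ?expf_neq0 // mulr1.
Qed.

Lemma soft_addl (x : R) (y : \bar R) :
  Ninv x -> (0 < y)%E -> (0 < x%:E + y)%E.
Proof. by move=> /Ninv_ge0 x0 y0; apply: lt_le_trans y0 _; rewrite leeDr ?lee_fin. Qed.

Lemma soft_addr (x : R) (y : \bar R) :
  Ninv x -> (0 < y)%E -> (0 < y + x%:E)%E.
Proof. by move=> x0 y0; rewrite addeC soft_addl. Qed.

Lemma soft_add (x y : \bar R) : (0 < x)%E -> (0 < y)%E -> (0 < x + y)%E.
Proof. exact: adde_gt0. Qed.

Definition Sp_zero : Sp := inl (exist _ 0%R Ninv0).

Definition Sp_add (a b : Sp) : Sp :=
  match a, b with
  | inl (exist x hx), inl (exist y hy) => inl (exist _ (x + y)%R (NinvD hx hy))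
  | inl (exist x hx), inr (exist y hy) =>
      inr (exist _ (x%:E + y)%E (soft_addl hx hy))
  | inr (exist y hy), inl (exist x hx) =>
      inr (exist _ (y + x%:E)%E (soft_addr hx hy))
  | inr (exist x hx), inr (exist y hy) => inr (exist _ (x + y)%E (soft_add hx hy))
  end.

Definition Sp_le (a b : Sp) : bool :=
  match a, b with
  | inl x, inl y => (val x <= val y)%R
  | inr y, inl x => (val y <= (val x)%:E)%E
  | inl x, inr y => ((val x)%:E < val y)%E
  | inr x, inr y => (val x <= val y)%E
  end.

Definition Sp_val (a : Sp) : \bar R :=
  match a with inl x => (val x)%:E | inr y => val y end.

Definition Sp_compact (a : Sp) : bool := if a is inl _ then true else false.

Lemma Sp_leE a b : Sp_le a b =
  ((Sp_val a < Sp_val b)%E ||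
   (Sp_val a == Sp_val b) && (Sp_compact a ==> Sp_compact b)).
Proof.
case: a b => [x|x] [y|y] /=; rewrite ?andbT ?andbF ?orbF //.
- by rewrite -lee_fin le_eqVlt orbC.
- by rewrite le_eqVlt orbC.
- by rewrite le_eqVlt orbC.
Qed.

Lemma Sp_eq a b : Sp_val a = Sp_val b -> Sp_compact a = Sp_compact b -> a = b.
Proof.
case: a b => [x|x] [y|y] //= xy _; congr (_ _); apply: val_inj => //.
by case: xy.
Qed.

Lemma Sp_val_ge0 a : (0 <= Sp_val a)%E.
Proof.
by case: a => [[x hx]|[x hx]] /=; [rewrite lee_fin Ninv_ge0|exact: ltW].
Qed.

Lemma Sp_val_fin a : Sp_compact a -> Sp_val a \is a fin_num.
Proof. by case: a. Qed.

Lemma Sp_valD a b : Sp_val (Sp_add a b) = (Sp_val a + Sp_val b)%E.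
Proof. by case: a b => [[x hx]|[x hx]] [[y hy]|[y hy]]. Qed.

Lemma Sp_compactD a b : Sp_compact (Sp_add a b) = Sp_compact a && Sp_compact b.
Proof. by case: a b => [[x hx]|[x hx]] [[y hy]|[y hy]]. Qed.

Lemma Sp_soft (y : \bar R) : (0 < y)%E ->
  exists a : Sp, Sp_val a = y /\ Sp_compact a = false.
Proof. by move=> y0; exists (inr (exist _ y y0)). Qed.

Lemma Sp_le_refl : reflexive Sp_le.
Proof. by move=> a; rewrite Sp_leE eqxx implybb orbT. Qed.

Lemma Sp_le_anti : antisymmetric Sp_le.
Proof.
move=> a b; rewrite !Sp_leE; case: ltgtP => //= ab /andP[ca cb].
by apply: Sp_eq => //; apply/idP/idP; apply/implyP.
Qed.

Lemma Sp_le_trans : transitive Sp_le.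
Proof.
move=> b a c; rewrite !Sp_leE => /orP[ab|/andP[/eqP -> ab]].
  by case/orP=> [bc|/andP[/eqP <- _]]; rewrite ?ab // (lt_trans ab bc).
case/orP=> [->//|/andP[/eqP -> bc]]; rewrite eqxx /= orbC.
by move: ab bc; do 3 case: Sp_compact.
Qed.

HB.instance Definition _ := Order.Le_isPOrder.Build cu_display Sp
  Sp_le_refl Sp_le_anti Sp_le_trans.

Implicit Types a b c : Sp.

Lemma Sp_leP a b : (a <= b) = ((Sp_val a < Sp_val b)%E ||
   (Sp_val a == Sp_val b) && (Sp_compact a ==> Sp_compact b)).
Proof. exact: Sp_leE. Qed.

Lemma Sp_lt_le a b : (Sp_val a < Sp_val b)%E -> a <= b.
Proof. by rewrite Sp_leP => ->. Qed.

Lemma Sp_le_val a b : a <= b -> (Sp_val a <= Sp_val b)%E.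
Proof. by rewrite Sp_leP => /orP[/ltW//|/andP[/eqP -> _]]. Qed.

Lemma Sp_val_soft_le a b : (Sp_val a <= Sp_val b)%E -> ~~ Sp_compact a -> a <= b.
Proof.
by rewrite Sp_leP le_eqVlt orbC => /orP[->//|->] /negPf ->; rewrite orbT.
Qed.

Lemma Sp_addA : associative Sp_add.
Proof.
move=> a b c; apply: Sp_eq; first by rewrite !Sp_valD addeA.
by rewrite !Sp_compactD andbA.
Qed.

Lemma Sp_addC : commutative Sp_add.
Proof.
move=> a b; apply: Sp_eq; first by rewrite !Sp_valD addeC.
by rewrite !Sp_compactD andbC.
Qed.

Lemma Sp_add0 : left_id Sp_zero Sp_add.
Proof.
by move=> a; apply: Sp_eq; rewrite ?Sp_valD ?Sp_compactD //= add0e.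
Qed.

Lemma Sp_ge0 a : Sp_zero <= a.
Proof.
case: a => [[x hx]|[y hy]]; last exact: hy.
exact: Ninv_ge0 hx.
Qed.

Lemma Sp_leD a b a' b' : a <= a' -> b <= b' -> Sp_add a b <= Sp_add a' b'.
Proof.
move=> aa bb; have va := Sp_le_val aa; have vb := Sp_le_val bb.
rewrite Sp_leP !Sp_valD !Sp_compactD.
have := leeD va vb; rewrite le_eqVlt orbC => /orP[->//|/[dup] E ->] /=.
apply/orP; right; apply/implyP => /andP[ca cb].
have fa := Sp_val_fin ca; have fb := Sp_val_fin cb.
move: aa bb; rewrite !Sp_leP ca cb /= => /orP[lta|/andP[_ ->]].
  by move/eqP: E (lte_leD fb lta vb) => ->; rewrite ltxx.
move=> /orP[ltb|/andP[_ ->]//].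
by move/eqP: E (lee_ltD fa va ltb) => ->; rewrite ltxx.
Qed.

HB.instance Definition _ := isPOMonoid.Build cu_display Sp
  Sp_addA Sp_addC Sp_add0 Sp_ge0 Sp_leD.

Lemma Sp_supE (z : nat -> Sp) : exists a,
  [/\ is_sup z a, Sp_val a = ereal_sup (range (Sp_val \o z)) &
      Sp_compact a -> exists n, z n = a].
Proof.
set w := ereal_sup _.
have zw n : (Sp_val (z n) <= w)%E by apply: ereal_sup_ubound; exists n.
have [[n zn]|nomax] := pselect (exists n, forall m, z m <= z n).
  exists (z n); split; [exact: is_sup_max| |by exists n].
  apply/le_anti; rewrite zw /=; apply: ge_ereal_sup => _ [m _ <-] /=.
  exact: Sp_le_val.
have ltw n : (Sp_val (z n) < w)%E.
  rewrite lt_neqAle zw andbT; apply/eqP => znw.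
  have [m /negP] : exists m, ~ z m <= z n.
    by apply/existsNP => zn; apply: nomax; exists n.
  rewrite Sp_leP znw negb_or => /andP[].
  rewrite lt_neqAle zw andbT negbK => /[dup] zmw -> /=.
  rewrite negb_imply => /andP[cm _]; apply: nomax; exists m => k.
  by rewrite Sp_leP (eqP zmw) cm implybT andbT orbC -le_eqVlt zw.
have w0 : (0 < w)%E by exact: le_lt_trans (Sp_val_ge0 _) (ltw 0%N).
have [a [aw ca]] := Sp_soft w0; exists a; split; rewrite ?ca //.
apply: is_supP => [n|t zt]; first by apply: Sp_lt_le; rewrite aw.
apply: Sp_val_soft_le; rewrite ?ca // aw.
by apply: ge_ereal_sup => _ [n _ <-]; exact: Sp_le_val.
Qed.

Lemma Sp_sup_val (z : nat -> Sp) a : is_sup z a ->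
  Sp_val a = ereal_sup (range (Sp_val \o z)) /\
  (Sp_compact a -> exists n, z n = a).
Proof.
by have [b [zb ? ?]] := Sp_supE z => /(is_sup_unique zb) <-.
Qed.

Lemma Sp_sup_gt (z : nat -> Sp) a (t : \bar R) : is_sup z a ->
  (t < Sp_val a)%E -> exists n, (t < Sp_val (z n))%E.
Proof.
by move=> /Sp_sup_val[-> _] /ereal_sup_gt[_ [n _ <-]]; exists n.
Qed.

Lemma gt0_approx (y : \bar R) : (0 < y)%E -> exists f : nat -> R,
  [/\ forall n, (0 < f n)%R, forall n, (f n < f n.+1)%R,
      forall n, ((f n)%:E < y)%E &
      forall t, (forall n, ((f n)%:E <= t)%E) -> (y <= t)%E].
Proof.
case: y => [r| |]; [|move=> _|by rewrite ltNge leNye]; last first.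
  exists (fun n => n.+1%:R)%R; split=> [n|n|n|].
  - by rewrite ltr0n.
  - by rewrite ltr_nat.
  - by rewrite ltry.
  move=> [t| |] ft; [|by []|by have := ft 0%N].
  have := ft (Num.trunc t); rewrite lee_fin leNgt.
  by rewrite truncnS_gt.
rewrite lte_fin => r0; exists (fun n => r - r / n.+2%:R)%R; split=> [n|n|n|].
- by rewrite subr_gt0 ltr_pdivrMr ?ltr0n// ltr_pMr// ltr1n.
- by rewrite ltrD2l ltrN2 ltr_pM2l// ltf_pV2 ?posrE ?ltr0n// ltr_nat.
- by rewrite lte_fin ltrBlDr ltrDl divr_gt0// ltr0n.
move=> [t| |] ft; [|by rewrite leey|by have := ft 0%N].
rewrite lee_fin leNgt; apply/negP => tr; rewrite -subr_gt0 in tr.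
have := ft (Num.trunc (r / (r - t))); rewrite lee_fin leNgt => /negP; apply.
rewrite ltrBrDr addrC -ltrBrDr ltr_pdivrMr ?ltr0n// mulrC -ltr_pdivrMr//.
by apply: lt_trans (truncnS_gt _) _; rewrite ltr_nat.
Qed.

Lemma Sp_soft_approx a : ~~ Sp_compact a -> exists u : nat -> Sp,
  [/\ is_sup u a, nondecreasing_seq u,
      forall n, (Sp_val (u n) < Sp_val (u n.+1))%E &
      forall n, (Sp_val (u n) < Sp_val a)%E].
Proof.
move=> ca; have a0 : (0 < Sp_val a)%E by case: a ca => [//|[y hy]].
have [f [f0 fi fa fsup]] := gt0_approx a0.
have f0' n : (0 < (f n)%:E)%E by rewrite lte_fin.
pose u n : Sp := inr (exist _ (f n)%:E (f0' n)).
have ui n : (Sp_val (u n) < Sp_val (u n.+1))%E by rewrite lte_fin.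
exists u; split=> //.
  apply: is_supP => [n|t ut]; first exact/Sp_lt_le/fa.
  by apply: Sp_val_soft_le => //; apply: fsup => n; exact: Sp_le_val (ut n).
by apply/nondecreasing_seqP => n; exact/Sp_lt_le/ui.
Qed.

Lemma Sp_way_below a b :
  a ≪ b <-> a <= b /\ ((Sp_val a < Sp_val b)%E \/ Sp_compact b).
Proof.
split=> [ab|[ab H] z s _ zs bs].
  split; first exact: way_below_le.
  case: (boolP (Sp_compact b)) => [|cb]; [by right|left].
  have [u [ub ui _ lub]] := Sp_soft_approx cb.
  have [n /Sp_le_val aun] := ab _ _ ui ub (lexx _).
  exact: le_lt_trans aun (lub n).
have strict : (Sp_val a < Sp_val s)%E -> exists n, a <= z n.
  by move=> /(Sp_sup_gt zs)[n azn]; exists n; exact: Sp_lt_le.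
have bs' := Sp_le_val bs; have ab' := Sp_le_val ab.
case: H => [lt_ab|cb]; first by apply: strict; exact: lt_le_trans bs'.
move: (bs); rewrite Sp_leP cb => /orP[lt_bs|/andP[_ /= cs]].
  by apply: strict; exact: le_lt_trans lt_bs.
have [_ /(_ cs)[n zn]] := Sp_sup_val zs.
by exists n; rewrite zn (le_trans ab).
Qed.

Lemma Sp_O1 (z : nat -> Sp) : nondecreasing_seq z -> exists s, is_sup z s.
Proof. by move=> _; have [a [za _ _]] := Sp_supE z; exists a. Qed.

Lemma Sp_O2 a : exists2 z : nat -> Sp, way_increasing z & is_sup z a.
Proof.
case: (boolP (Sp_compact a)) => ca.
  exists (fun=> a); last exact: is_sup_max 0%N _.
  by move=> n; apply/Sp_way_below; split=> //; right.
have [u [ua _ ui _]] := Sp_soft_approx ca; exists u => // n.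
by apply/Sp_way_below; split; [exact: Sp_lt_le|left].
Qed.

Lemma Sp_way_below_fin a b : a ≪ b -> Sp_val a \is a fin_num.
Proof.
move=> /Sp_way_below[ab H]; rewrite ge0_fin_numE ?Sp_val_ge0//.
case: H => [lt_ab|/Sp_val_fin]; first exact: lt_le_trans lt_ab (leey _).
by rewrite ge0_fin_numE ?Sp_val_ge0//; exact: le_lt_trans (Sp_le_val ab).
Qed.

Lemma Sp_O3 (a' a b' b : Sp) : a' ≪ a -> b' ≪ b -> a' + b' ≪ a + b.
Proof.
move=> aa bb; have fa := Sp_way_below_fin aa; have fb := Sp_way_below_fin bb.
move: aa bb => /Sp_way_below[aa Ha] /Sp_way_below[bb Hb].
have va := Sp_le_val aa; have vb := Sp_le_val bb.
apply/Sp_way_below; split; first exact: Sp_leD.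
rewrite !Sp_valD Sp_compactD.
case: Ha => [lta|ca]; first by left; exact: lte_leD.
case: Hb => [ltb|cb]; first by left; exact: lee_ltD.
by right; rewrite ca.
Qed.

Lemma Sp_O4 (x y : nat -> Sp) (s t : Sp) :
  nondecreasing_seq x -> nondecreasing_seq y ->
  is_sup x s -> is_sup y t -> is_sup (fun n => x n + y n) (s + t).
Proof.
move=> xi yi xs yt; apply: is_supP => [n|u ub].
  by apply: Sp_leD; exact: is_sup_ub.
have [vs cs] := Sp_sup_val xs; have [vt ct] := Sp_sup_val yt.
case: (boolP (Sp_compact (s + t))) => [|cst].
  rewrite Sp_compactD => /andP[/cs[n <-] /ct[m <-]].
  apply: le_trans (ub (maxn n m)).
  by apply: Sp_leD; [apply/xi/leq_maxl|apply/yi/leq_maxr].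
apply: Sp_val_soft_le => //; rewrite Sp_valD.
have vmono (z : nat -> Sp) : nondecreasing_seq z ->
    {homo (Sp_val \o z) : m n / (m <= n)%N >-> (m <= n)%E}.
  by move=> zi m n mn; exact/Sp_le_val/zi.
have cx := ereal_nondecreasing_cvgn (vmono _ xi); rewrite -vs in cx.
have cy := ereal_nondecreasing_cvgn (vmono _ yi); rewrite -vt in cy.
have cxy : (Sp_val (x n) + Sp_val (y n))%E @[n --> \oo] -->
    (Sp_val s + Sp_val t)%E.
  by apply: cvgeD => //; exact: ge0_adde_def (Sp_val_ge0 s) (Sp_val_ge0 t).
rewrite -(cvg_lim _ cxy)//; apply: lime_le; first by apply/cvg_ex; eexists; exact: cxy.
by apply: nearW => n /=; rewrite -Sp_valD; exact: Sp_le_val.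
Qed.

HB.instance Definition _ := isCuSemigroup.Build Sp Sp_O1 Sp_O2 Sp_O3 Sp_O4.

End Sp.

(* Main.v *)
Require Import Defs.
From mathcomp Require Import all_boot all_order all_algebra.
From mathcomp Require Import boolp classical_sets functions cardinality.
From mathcomp Require Import reals ereal sequences.

(** A Fraisse sequence of the category is a sequence of copies of [natbar] with
    bonding maps [x |-> p ^ (e j - e i) x], where [e] is nondecreasing, and the
    Fraisse property applied to multiplication by [p] forces [e] to be
    unbounded. The maps [n |-> (n / p ^ e i)_c], [oo |-> oo_s] into [Sp] form a
    cocone, which reflects the order on compact elements, and every element of
    [Sp] is the supremum of an increasing sequence of elements [(n / p ^ e i)_c]
    because these are dense. As maps in Cu preserve suprema, this determines the
    map induced by a cocone: it is the extension by suprema of its values on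
    compact elements, those that are way below themselves. *)

Set Implicit Arguments.
Unset Strict Implicit.
Unset Printing Implicit Defensive.

Import Order.TTheory GRing.Theory Num.Theory.
Local Open Scope classical_set_scope.
Local Open Scope order_scope.
Local Open Scope cu_scope.

(** * Compatibility of the way-below relation with the order *)

Section WayBelow.
Variables (d : Order.disp_t) (T : porderType d).
Implicit Types x y z : T.

Lemma way_below_le_trans x y z : x ≪ y -> y <= z -> x ≪ z.
Proof. by move=> xy yz w s wi ws zs; apply: xy wi ws (le_trans yz zs). Qed.

Lemma le_way_below_trans x y z : x <= y -> y ≪ z -> x ≪ z.
Proof.
move=> xy yz w s wi ws zs; have [n yw] := yz _ _ wi ws zs.
by exists n; exact: le_trans yw.
Qed.

End WayBelow.

(** * A criterion for limits of sequences of algebraic semigroups *)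

Section AlgebraicLimit.
Variables (S : nat -> cuType) (bond : forall i j, S i -> S j).
Variables (L : cuType) (phi : forall i, S i -> L).
Arguments bond : clear implicits.
Hypothesis bond_cu : forall i j, (i <= j)%N -> cu_morphism (bond i j).
Hypothesis phi_cocone : cu_cocone bond phi.
Hypothesis phi_reflect : forall i j (x : S i) (y : S j), x ≪ x -> y ≪ y ->
  phi x <= phi y ->
  exists k, [/\ (i <= k)%N, (j <= k)%N & bond i k x <= bond j k y].

Let elt := {i : nat & S i}.
Let compact (m : elt) := projT2 m ≪ projT2 m.
Let push (T : cuType) (f : forall i, S i -> T) (m : elt) := f _ (projT2 m).
(** The terms may come from different stages; only their images in [L] are required to increase. *)
Let approx (m : nat -> elt) (a : L) := [/\ forall n, compact (m n),
  nondecreasing_seq (push phi \o m) & is_sup (push phi \o m) a].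

Hypothesis phi_dense : forall a, exists m, approx m a.
Hypothesis S_algebraic : forall i (x : S i), exists z : nat -> S i,
  [/\ forall n, z n ≪ z n, nondecreasing_seq z & is_sup z x].

Section Universal.
Variables (T : cuType) (psi : forall i, S i -> T).
Hypothesis psi_cocone : cu_cocone bond psi.

Lemma cocone_bond (U : cuType) (f : forall i, S i -> U) i j (x : S i) :
  cu_cocone bond f -> (i <= j)%N -> f _ (bond i j x) = f _ x.
Proof. by move=> [_ fb] /fb <-. Qed.

(** An inequality in [L] between compact elements already holds at some stage [k], from where [psi]
    carries it to [T]. *)
Lemma push_mono m m' : compact m -> compact m' ->
  push phi m <= push phi m' -> push psi m <= push psi m'.
Proof.
move=> cm cm' /(phi_reflect cm cm')[k [ik jk xy]]; rewrite /push.
rewrite -(cocone_bond _ psi_cocone ik) -(cocone_bond _ psi_cocone jk).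
by have [psi_cu _] := psi_cocone; have [_ _ + _ _] := psi_cu k; apply.
Qed.

(** Both elements are moved to the later of their two stages and added there. One witness serves
    [phi] and [psi] at once, so that sums of approximations in [L] and in [T] correspond. *)
Lemma push_add m m' : compact m -> compact m' -> exists m'', [/\ compact m'',
  push phi m'' = push phi m + push phi m' &
  push psi m'' = push psi m + push psi m'].
Proof.
move=> cm cm'; set i := projT1 m; set j := projT1 m'.
have ik : (i <= maxn i j)%N by exact: leq_maxl.
have jk : (j <= maxn i j)%N by exact: leq_maxr.
have addE (U : cuType) (f : forall i, S i -> U) : cu_cocone bond f ->
    f _ (bond i (maxn i j) (projT2 m) + bond j (maxn i j) (projT2 m')) =
    push f m + push f m'.
  move=> fc; have [/(_ (maxn i j))[_ -> _ _ _] _] := fc.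
  by rewrite !cocone_bond.
exists (existT _ (maxn i j) (bond _ _ (projT2 m) + bond _ _ (projT2 m'))).
split; [|exact: addE phi_cocone|exact: addE psi_cocone].
have [_ _ _ bi _] := bond_cu ik; have [_ _ _ bj _] := bond_cu jk.
by apply: cu_O3; [exact: bi|exact: bj].
Qed.

(** The graph of the induced map, as a relation: that [t] does not depend on the approximation
    chosen is proved afterwards. *)
Definition mediating_value a t := exists2 m, approx m a & is_sup (push psi \o m) t.

(** The image of [m n] is way below itself and lies below the supremum [b], hence below some term of
    the approximation [m']. *)
Lemma approx_le m m' a b t n : approx m a -> approx m' b -> a <= b ->
  is_sup (push psi \o m') t -> push psi (m n) <= t.
Proof.
move=> [cm mi ma] [cm' mi' mb] ab mt.
have [_ _ _ wphi _] := phi_cocone.1 (projT1 (m n)).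
have [k mk] : exists k, push phi (m n) <= push phi (m' k).
  apply: (wphi _ _ (cm n)) mi' mb _.
  exact: le_trans (is_sup_ub n ma) ab.
exact: le_trans (push_mono (cm n) (cm' k) mk) (is_sup_ub k mt).
Qed.

Lemma value_le a b s t : mediating_value a s -> mediating_value b t -> a <= b -> s <= t.
Proof.
move=> [m ma ms] [m' mb mt] ab; apply: (is_sup_lub ms) => n.
exact: approx_le ma mb ab mt.
Qed.

(** Two approximations of [a] give suprema each below the other, so any of them computes the
    value. *)
Lemma approx_value m a t : approx m a -> mediating_value a t -> is_sup (push psi \o m) t.
Proof.
move=> ma [m' ma' mt]; apply: is_supP => [n|s ms].
  exact: approx_le ma ma' (lexx _) mt.
have [cm mi _] := ma.
have [s' ms'] : exists s', is_sup (push psi \o m) s'.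
  by apply: cu_O1 => i j ij; apply: push_mono => //; exact: mi.
apply: (@le_trans _ _ s'); last exact: is_sup_lub ms' ms.
by apply: (value_le (a := a) (b := a)) (lexx _); [exists m'|exists m].
Qed.

Lemma value_ex a : exists t, mediating_value a t.
Proof.
have [m [cm mi ma]] := phi_dense a.
have [t mt] : exists t, is_sup (push psi \o m) t.
  by apply: cu_O1 => i j ij; apply: push_mono => //; exact: mi.
by exists t, m.
Qed.

Lemma value_push m : compact m -> mediating_value (push phi m) (push psi m).
Proof.
move=> cm; exists (fun=> m); last exact: (is_sup_max (n := 0%N)).
by split=> //; exact: (is_sup_max (n := 0%N)).
Qed.

(** * The induced map is a Cu-morphism and is unique *)

Section Mediating.
Variable u : L -> T.
Hypothesis u_value : forall a, mediating_value a (u a).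

Lemma mediating_push m : compact m -> u (push phi m) = push psi m.
Proof.
move=> /value_push um; apply/le_anti/andP.
by split; apply: value_le (lexx (push phi m)).
Qed.

Lemma mediating_le : {homo u : a b / a <= b}.
Proof. by move=> a b; exact: value_le. Qed.

Lemma mediating_phi i : u \o @phi i = @psi i.
Proof.
(* As [x] need not be compact, it is approximated inside its own stage; the images of [z] then
   approximate [phi x]. *)
apply/funext => x /=; have [z [zc zi zx]] := S_algebraic x.
have [_ _ phi_le _ phi_sup] := phi_cocone.1 i.
have [_ _ _ _ psi_sup] := psi_cocone.1 i.
apply: (is_sup_unique _ (psi_sup _ _ zi zx)).
apply: (@approx_value (fun n => existT _ i (z n)) (phi x)); last exact: u_value.
split=> //; first by move=> j k jk; apply: phi_le; exact: zi.
exact: phi_sup.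
Qed.

Lemma mediating_add : {morph u : a b / a + b}.
Proof.
move=> a b.
have [m ma] := phi_dense a; have [m' mb] := phi_dense b.
have um := approx_value ma (u_value a); have um' := approx_value mb (u_value b).
move: ma mb => [cm mi ma] [cm' mi' mb].
(* The termwise sums approximate [a + b], by (O4) in [L]; (O4) in [T] then gives the value. *)
have [q qP] := choice (fun n => push_add (cm n) (cm' n)).
have qphi : push phi \o q = fun n => push phi (m n) + push phi (m' n).
  by apply/funext => n; have [] := qP n.
have qpsi : push psi \o q = fun n => push psi (m n) + push psi (m' n).
  by apply/funext => n; have [] := qP n.
have qab : approx q (a + b).
  split; first by move=> n; have [] := qP n.
    by rewrite qphi => i j ij; apply: cu_leD; [exact: mi|exact: mi'].
  by rewrite qphi; exact: cu_O4.
apply: is_sup_unique (approx_value qab (u_value _)) _.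
rewrite qpsi; apply: cu_O4 um um' => i j ij; apply: push_mono => //.
  exact: mi.
exact: mi'.
Qed.

(** A compact element fits between [a] and [b], and its image is way below itself in [T]. *)
Lemma mediating_way_below : {homo u : a b / a ≪ b}.
Proof.
move=> a b ab; have [m [cm mi mb]] := phi_dense b.
have [n am] := ab _ _ mi mb (lexx _).
apply: le_way_below_trans (mediating_le am) _.
apply: (@way_below_le_trans _ _ _ (u (push phi (m n)))); last first.
  by apply: mediating_le; exact: is_sup_ub n mb.
rewrite mediating_push //.
by have [_ _ _ + _] := psi_cocone.1 (projT1 (m n)); apply; exact: cm.
Qed.

Lemma mediating_sup (z : nat -> L) (s : L) :
  nondecreasing_seq z -> is_sup z s -> is_sup (u \o z) (u s).
Proof.
move=> zi zs; have [m ms] := phi_dense s.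
have um := approx_value ms (u_value s); move: ms => [cm mi ms].
apply: is_supP => [n|t zt]; first by apply: mediating_le; exact: is_sup_ub.
apply: (is_sup_lub um) => n /=; rewrite -mediating_push //.
have [_ _ _ wphi _] := phi_cocone.1 (projT1 (m n)).
have [k mk] : exists k, push phi (m n) <= z k.
  exact: (wphi _ _ (cm n)) zi zs (is_sup_ub n ms).
exact: le_trans (mediating_le mk) (zt k).
Qed.

Lemma mediating_cu : cu_morphism u.
Proof.
split; [|exact: mediating_add|exact: mediating_le|exact: mediating_way_below|
  exact: mediating_sup].
have [phi0 _ _ _ _] := phi_cocone.1 0%N.
have [psi0 _ _ _ _] := psi_cocone.1 0%N.
by rewrite -phi0 -psi0 -(mediating_phi 0).
Qed.

(** A Cu-morphism preserves suprema, so its values on an approximation determine it. *)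
Lemma mediating_unique v :
  cu_morphism v /\ (forall i, v \o @phi i = @psi i) -> u = v.
Proof.
move=> [[_ _ _ _ v_sup] vphi]; apply/funext => a.
have [m ma] := phi_dense a; have um := approx_value ma (u_value a).
move: ma => [_ mi ma]; apply: is_sup_unique um _.
have -> : push psi \o m = v \o (push phi \o m).
  by apply/funext => n; rewrite /push /= -vphi.
exact: v_sup.
Qed.

End Mediating.
End Universal.

Lemma algebraic_cu_limit : cu_limit bond phi.
Proof.
split=> // T psi psi_cocone.
have [u uP] := choice (value_ex psi_cocone).
exists u; split; first by split; [exact: mediating_cu uP|exact: mediating_phi uP].
exact: mediating_unique uP.
Qed.

End AlgebraicLimit.

(** * The category of multiplications by powers of [p] is Fraïssé *)

Section PowCategory.
Variable p : nat.

(** Case analysis on the indexed family needs variable ends, so these are generalized along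
    equalities; the transports vanish by irrelevance of equality proofs. *)
Lemma pow_homP (f : natbar -> natbar) :
  pow_hom p (f : (natbar : cuType) -> (natbar : cuType)) ->
  exists k, f = fun x => x *+ (p ^ k)%N.
Proof.
suff H (S T : cuType) (g : S -> T) (eS : S = natbar) (eT : T = natbar) :
    pow_hom p g -> exists k, eq_rect _ (fun B : cuType => natbar -> B)
      (eq_rect _ (fun A : cuType => A -> T) g _ eS) _ eT =
      fun x : natbar => x *+ (p ^ k)%N.
  exact: (H _ _ _ erefl erefl).
move=> hg; case: hg eS eT => k eS eT.
by rewrite (Prop_irrelevance eS erefl) (Prop_irrelevance eT erefl); exists k.
Qed.

Lemma approx_on_refl (S T : cuType) (F : set S) (f : S -> T) :
  cu_morphism f -> approx_on F f f.
Proof. by move=> [_ _ f_le _ _] x' x _ _ /way_below_le /f_le. Qed.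

Lemma natbar_mulnC (m n : nat) (x : natbar) : x *+ m *+ n = x *+ n *+ m.
Proof. by rewrite -!cu_mulnA mulnC. Qed.

Lemma natbar_muln_fin (m n : nat) : (NFin m : natbar) *+ n = NFin (n * m).
Proof. by elim: n => //= n ->. Qed.

Lemma countably_based_natbar : countably_based (natbar : cuType).
Proof.
exists (range option_natbar) => [|x].
  exact: sub_countable (card_image_le _ _) (countableP _).
have [z zw zx] := natbar_O2 x; exists z; split=> // n.
by exists (natbar_option (z n)) => //; rewrite natbar_optionK.
Qed.

Lemma pow_joint_embedding : joint_embedding (pow_category p).
Proof.
move=> A1 A2 -> ->; exists natbar.
by split=> //; exists idfun; exact: pow_hom_id.
Qed.

Lemma pow_near_amalgamation : near_amalgamation (pow_category p).
Proof.
move=> A B1 B2 f1 f2 F h1 h2 _.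
have [eA eB1] := pow_hom_ob h1; have [_ eB2] := pow_hom_ob h2.
rewrite /pow_ob /= in eA eB1 eB2; subst A B1 B2.
have [k ->] := pow_homP h1; have [l ->] := pow_homP h2.
(* Multiplications commute, so each side is completed by the other map and the square commutes
   exactly. *)
exists natbar, (fun x => x *+ (p ^ l)%N), (fun x => x *+ (p ^ k)%N).
split=> //.
rewrite (_ : _ \o (fun x => x *+ (p ^ l)%N) =
  (fun x => x *+ (p ^ l)%N) \o (fun x => x *+ (p ^ k)%N)); last first.
  by apply/funext => x /=; exact: natbar_mulnC.
exact/approx_on_refl/pow_hom_cu/(pow_hom_comp (PowHom p k) (PowHom p l)).
Qed.

(** With one object and countably many morphisms, the category serves as its own countable
    subcategory. *)
Lemma pow_separability : separability (pow_category p).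
Proof.
exists (pow_category p); split; first by split=> [?|? ? ?].
- by move=> S ->; exact: countably_based_natbar.
- apply: (@sub_countable _ _ _ (range (fun k : nat =>
    existT (fun S : cuType => {T : cuType & S -> T}) natbar
      (existT (fun T : cuType => natbar -> T) natbar
        (fun x : natbar => x *+ (p ^ k)%N))))); last first.
    exact: sub_countable (card_image_le _ _) (countableP _).
  apply: subset_card_le => -[S [T f]]; rewrite /morphisms /=.
  by case=> k; exists k.
- by move=> A ->; exists natbar => //; exists idfun; exact: pow_hom_id.
move=> S A f F _ hf _; have [_ eA] := pow_hom_ob hf.
exists A, idfun, f; split=> //; first exact: pow_hom_id.
exact/approx_on_refl/pow_hom_cu/hf.
Qed.

(** * Fraïssé sequences: existence, and their form in general *)

Definition pow_bond (e : nat -> nat) (i j : nat) (x : natbar) : natbar :=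
  x *+ (p ^ (e j - e i))%N.

Lemma pow_fraisse_sequence : @fraisse_sequence (pow_category p)
  (fun=> natbar : cuType) (pow_bond id).
Proof.
split=> [|i|i F C f _ hf]; last 1 first.
- have [_ eC] := pow_hom_ob hf; rewrite /pow_ob /= in eC; subst C.
  (* The bonding map from [i] to [i + k] is itself multiplication by [p ^ k], so the identity is the
     map back. *)
  have [k ->] := pow_homP hf; exists (i + k)%N; split; first exact: leq_addr.
  exists idfun; first exact: pow_hom_id.
  rewrite /pow_bond addKn; exact/approx_on_refl/cu_muln_morphism.
- split=> [//|i j ij|i|i j k /andP[ij jk]]; first exact: PowHom.
    by apply/funext => x; rewrite /pow_bond subnn expn0 /= cu_addC cu_add0.
  apply/funext => x; rewrite /pow_bond /= -cu_mulnA -expnD.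
  by rewrite addnBA // subnK.
- exact: countably_based_natbar.
Qed.

Lemma fraisse_sequence_pow_bond (bond : nat -> nat -> natbar -> natbar) :
  prime p -> @fraisse_sequence (pow_category p) (fun=> natbar : cuType) bond ->
  exists e : nat -> nat, [/\ {homo e : i j / (i <= j)%N},
    forall n, exists i, (n <= e i)%N &
    forall i j, (i <= j)%N -> bond i j = pow_bond e i j].
Proof.
move=> p_prime [[_ hb _ bondC] _ fr].
have p1 := prime_gt1 p_prime; have p0 := prime_gt0 p_prime.
(* [e i] is the exponent of the bonding map from stage 0 to stage [i]. *)
have [e eP] := choice (fun i => pow_homP (hb 0%N i (leq0n i))).
have bondE i j : (i <= j)%N ->
    exists2 k, bond i j = (fun x => x *+ (p ^ k)%N) & e j = (k + e i)%N.
  move=> ij; have [k bk] := pow_homP (hb i j ij); exists k => //.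
  (* Evaluation at 1 turns the composition law into an equality of powers of [p], whose exponents
     agree as [p > 1]. *)
  have /(congr1 (@^~ (NFin 1))) : bond i j \o bond 0%N i = bond 0%N j.
    by apply: bondC; rewrite ij.
  rewrite /= bk !eP !natbar_muln_fin !muln1 -expnD => -[] /eqP.
  by rewrite eqn_exp2l // => /eqP.
exists e; split.
- by move=> i j /bondE[k _ ->]; exact: leq_addl.
- elim=> [|n [i ni]]; first by exists 0%N.
  (* Tested at the compact element 1, the Fraïssé property for multiplication by [p] gives
     [p ^ (l + 1) <= p ^ k], so [k] is positive and [e j > e i]. *)
  have [j [ij [g hg gf]]] := fr i [set NFin 1] natbar
    (fun x : natbar => x *+ (p ^ 1)%N) (finite_set1 _) (PowHom p 1).
  exists j; have [k bk ->] := bondE i j ij.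
  have [l gl] := pow_homP hg.
  have : (NFin 1 : natbar) ≪ NFin 1 by apply/natbar_way_below.
  move=> /(gf _ _ erefl erefl)[+ _]; rewrite bk gl /= !natbar_muln_fin.
  rewrite !muln1 -[_ <= _]/(_ <= _)%N -expnD leq_exp2l // addn1 => lk.
  by rewrite -add1n leq_add // (leq_ltn_trans _ lk).
by move=> i j /bondE[k -> ek]; rewrite /pow_bond ek addnK.
Qed.

End PowCategory.

(** * The semigroup [Sp] as a limit of copies of [natbar] *)

Section SpLimit.
Variables (R : realType) (p : nat).
Hypothesis p_prime : prime p.

Let p_gt0 n : (0 < p%:R ^+ n :> R)%R.
Proof. by rewrite exprn_gt0 // ltr0n prime_gt0. Qed.

Lemma Ninv_frac (n e : nat) : Ninv p (n%:R / p%:R ^+ e : R)%R.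
Proof. by apply/asboolP; exists n, e. Qed.

Definition Sp_frac (e n : nat) : Sp R p :=
  inl (exist (fun x : R => Ninv p x) _ (Ninv_frac n e)).

Definition Sp_infty : Sp R p :=
  inr (exist (fun y : \bar R => (0 < y)%E) +oo%E lt0y).

(** [NInf] must go to the supremum of the fractions [n / p ^ e], which is the soft infinity. *)
Definition Sp_embed (e : nat) (x : natbar) : Sp R p :=
  if x is NFin n then Sp_frac e n else Sp_infty.

Lemma Sp_frac_le (e e' m n : nat) :
  (Sp_frac e m <= Sp_frac e' n) = (m * p ^ e' <= n * p ^ e)%N.
Proof.
rewrite -[LHS]/(_ <= _)%R /= ler_pdivrMr // mulrAC ler_pdivlMr //.
by rewrite -!natrX -!natrM ler_nat.
Qed.

Lemma Sp_frac_compact e n : Sp_frac e n ≪ Sp_frac e n.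
Proof. by apply/Sp_way_below; split=> //; right. Qed.

Lemma Sp_fracD e m n : Sp_frac e (m + n) = Sp_frac e m + Sp_frac e n.
Proof.
apply: Sp_eq; last by rewrite Sp_compactD.
by rewrite Sp_valD /= natrD mulrDl.
Qed.

Lemma Sp_frac_expn e d n : Sp_frac (d + e) (p ^ d * n) = Sp_frac e n.
Proof.
by apply/le_anti; rewrite !Sp_frac_le [(_ * n)%N]mulnC -mulnA -expnD leqnn.
Qed.

Lemma Sp_le_infty (a : Sp R p) : a <= Sp_infty.
Proof.
rewrite Sp_leP /=; case: a => [x|y] /=; first by rewrite ltry.
by rewrite andbT orbC -le_eqVlt leey.
Qed.

Lemma Sp_embed_le e : {homo Sp_embed e : x y / x <= y}.
Proof.
move=> [m|] [n|] //= mn; last exact: Sp_le_infty.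
by rewrite Sp_frac_le leq_mul2r (mn : (m <= n)%N) orbT.
Qed.

Lemma is_sup_Sp_infty (z : nat -> Sp R p) e :
  (forall k, exists n, Sp_frac e k <= z n) -> is_sup z Sp_infty.
Proof.
move=> unb; apply: is_supP => [n|t zt]; first exact: Sp_le_infty.
have ft k : Sp_frac e k <= t by have [n kn] := unb k; exact: le_trans (zt n).
(* A soft element lies below every element of at least its value, so only a finite value of [t] must
   be excluded. *)
suff tE : Sp_val t = +oo%E by apply: Sp_val_soft_le; rewrite ?tE.
apply/eqP; apply: contraT => tfin.
have : Sp_val t \is a fin_num by rewrite ge0_fin_numE ?Sp_val_ge0// ltey.
move=> /fineK tE; pose r := (fine (Sp_val t) * p%:R ^+ e)%R.
have /Sp_le_val := ft (Num.truncn r).+1; rewrite -tE lee_fin ler_pdivrMr //.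
by rewrite leNgt truncnS_gt.
Qed.

Lemma Sp_embed_cu e : cu_morphism (Sp_embed e).
Proof.
split; [| |exact: Sp_embed_le| |].
- by apply: Sp_eq => //=; rewrite mul0r.
- move=> [m|] [n|] /=; first exact: Sp_fracD.
  + by apply: Sp_eq; rewrite ?Sp_valD ?Sp_compactD.
  + by apply: Sp_eq; rewrite ?Sp_valD ?Sp_compactD.
  + by apply: Sp_eq; rewrite ?Sp_valD ?Sp_compactD.
- move=> x y /natbar_way_below[xy]; case: x xy => [m|//] my _.
  exact: way_below_le_trans (@Sp_frac_compact e m) (@Sp_embed_le e (NFin m) y my).
move=> z s zi zs; have [[n zn]|[zoo unb]] := natbar_sup_cases zi.
  rewrite (is_sup_unique zs (is_sup_max zn)).
  by apply: (is_sup_max (n := n)) => m; exact/Sp_embed_le/zn.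
rewrite (is_sup_unique zs zoo); apply: (@is_sup_Sp_infty _ e) => k.
by have [n kn] := unb k; exists n; exact: (@Sp_embed_le e (NFin k)).
Qed.

Variable e : nat -> nat.
Hypothesis e_le : {homo e : i j / (i <= j)%N}.
Hypothesis e_unbounded : forall n, exists i, (n <= e i)%N.

Let phi (i : nat) : (natbar : cuType) -> Sp R p := Sp_embed (e i).

Lemma Sp_embed_cocone :
  @cu_cocone (fun=> natbar : cuType) (pow_bond p e) (Sp R p) phi.
Proof.
split=> [i|i j ij]; first exact: Sp_embed_cu.
apply/funext => -[n|] /=.
  by rewrite /pow_bond natbar_muln_fin /phi /= -{1}(subnK (e_le ij)) Sp_frac_expn.
(* Positivity of the factor matters here, because [NInf *+ 0] is 0. *)
rewrite /pow_bond /phi; set k := (p ^ _)%N.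
have : (0 < k)%N by rewrite expn_gt0 prime_gt0.
by case: k.
Qed.

Lemma Sp_frac_dense (s t : R) : (0 <= s)%R -> (s < t)%R -> exists i n,
  (s%:E < Sp_val (Sp_frac (e i) n) < t%:E)%E.
Proof.
(* Since [e i < p ^ e i], this makes the mesh [1 / p ^ e i] smaller than [t - s]; the numerator is
   then the first integer above [s * p ^ e i]. *)
move=> s0 st; have [i ei] := e_unbounded (Num.truncn (t - s)^-1).+1.
pose q : R := (p%:R ^+ e i)%R; have q0 : (0 < q)%R by exact: p_gt0.
exists i, (Num.truncn (s * q)).+1; rewrite /= !lte_fin.
rewrite ltr_pdivlMr // ltr_pdivrMr // truncnS_gt /=.
have /andP[tr _] := truncn_itv (mulr_ge0 s0 (ltW q0)).
rewrite -natr1; apply: le_lt_trans (lerD tr (lexx 1%R)) _.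
have ts : (0 < t - s)%R by rewrite subr_gt0.
rewrite -ltrBrDl -mulrBl mulrC -ltr_pdivrMr // mul1r.
apply: lt_trans (truncnS_gt _) _; rewrite /q -natrX ltr_nat.
exact: leq_ltn_trans ei (ltn_expl _ (prime_gt1 p_prime)).
Qed.

Lemma Sp_approx (a : Sp R p) : exists m : nat -> {i : nat & natbar},
  [/\ forall n, projT2 (m n) ≪ projT2 (m n),
      nondecreasing_seq (fun n => phi (projT1 (m n)) (projT2 (m n))) &
      is_sup (fun n => phi (projT1 (m n)) (projT2 (m n))) a].
Proof.
case: (boolP (Sp_compact a)) => ca.
  have [i [n an]] : exists i n, a = Sp_frac (e i) n.
    case: a ca => [[x hx]|//] _; have /asboolP[k [l xE]] := hx.
    (* The fraction [k / p ^ l] is expanded to a denominator that occurs in the sequence. *)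
    have [i li] := e_unbounded l; exists i, (p ^ (e i - l) * k)%N.
    by rewrite -{1}(subnK li) Sp_frac_expn; apply: Sp_eq => //=; rewrite xE.
  exists (fun=> existT _ i (NFin n)); split=> //=.
    by move=> _; apply/natbar_way_below.
  by rewrite an; exact: (is_sup_max (n := 0%N)).
have a0 : (0 < Sp_val a)%E by case: a ca => [//|[y hy]].
have [f [f0 fi fa fsup]] := gt0_approx a0.
(* Fractions strictly between consecutive terms of [f] increase and have the same supremum as
   [f]. *)
have [i iP] := choice (fun n => Sp_frac_dense (ltW (f0 n)) (fi n)).
have [k kP] := choice iP.
exists (fun n => existT _ (i n) (NFin (k n))); split=> /=.
- by move=> n; apply/natbar_way_below.
- apply/nondecreasing_seqP => n; apply: Sp_lt_le.
  have /andP[_ lt1] := kP n; have /andP[lt2 _] := kP n.+1.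
  exact: lt_trans lt1 lt2.
apply: is_supP => [n|t ut].
  by have /andP[_ ltf] := kP n; apply: Sp_lt_le; exact: lt_trans ltf (fa _).
apply: Sp_val_soft_le => //; apply: fsup => n.
have /andP[ltf _] := kP n; exact: le_trans (ltW ltf) (Sp_le_val (ut n)).
Qed.

Lemma Sp_embed_reflect i j (x y : natbar) : x ≪ x -> y ≪ y ->
  phi i x <= phi j y -> exists k, [/\ (i <= k)%N, (j <= k)%N &
    pow_bond p e i k x <= pow_bond p e j k y].
Proof.
move=> /natbar_way_below[_]; case: x => // m _.
move=> /natbar_way_below[_]; case: y => // n _ mn.
exists (maxn i j); split; [exact: leq_maxl|exact: leq_maxr|].
rewrite /pow_bond !natbar_muln_fin -[_ <= _]/(_ <= _)%N.
(* Over the common denominator of stage [maxn i j], the order of fractions is that of numerators. *)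
have := mn; rewrite /phi /= -(Sp_frac_expn (e i) (e (maxn i j) - e i)).
rewrite -(Sp_frac_expn (e j) (e (maxn i j) - e j)).
rewrite !subnK ?e_le ?leq_maxl ?leq_maxr // Sp_frac_le leq_mul2r.
by rewrite expn_eq0 eqn0Ngt prime_gt0.
Qed.

(** The terms of a way-below increasing sequence are finite, and finite elements are compact. *)
Lemma natbar_algebraic (x : natbar) : exists z : nat -> natbar,
  [/\ forall n, z n ≪ z n, nondecreasing_seq z & is_sup z x].
Proof.
have [z zw zx] := natbar_O2 x; exists z; split=> //.
  move=> n; apply/natbar_way_below; split=> //.
  by have /natbar_way_below[] := zw n.
by apply/nondecreasing_seqP => n; exact/way_below_le/zw.
Qed.

Lemma Sp_limit :
  @cu_limit (fun=> natbar : cuType) (pow_bond p e) (Sp R p) phi.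
Proof.
apply: algebraic_cu_limit.
- by move=> i j _; exact: cu_muln_morphism.
- exact: Sp_embed_cocone.
- exact: Sp_embed_reflect.
- exact: Sp_approx.
- by move=> _; exact: natbar_algebraic.
Qed.

End SpLimit.

(** A Fraïssé sequence determines [bond i j] only for [i <= j], so it cannot be replaced by
    [pow_bond] as a function. *)
Lemma cu_limit_eq_bond (S : nat -> cuType) (bond bond' : forall i j, S i -> S j)
    (L : cuType) (phi : forall i, S i -> L) :
  (forall i j, (i <= j)%N -> bond i j = bond' i j) ->
  cu_limit bond phi -> cu_limit bond' phi.
Proof.
move=> bb; have coconeE (T : cuType) (psi : forall i, S i -> T) :
    cu_cocone bond psi <-> cu_cocone bond' psi.
  by split=> -[psi_cu psi_bond]; split=> // i j ij; rewrite -(psi_bond _ _ ij) bb.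
by move=> [/coconeE phi_cocone phi_univ]; split=> // T psi /coconeE; exact: phi_univ.
Qed.

Theorem theorem4p2 (R : realType) (p : nat) (p_prime : prime p) :
  fraisse_category (pow_category p) /\
  is_fraisse_limit (pow_category p) (Sp R p).
Proof.
split.
  split; [exact: pow_joint_embedding|exact: pow_near_amalgamation|].
  exact: pow_separability.
split; first by eexists; eexists; exact: pow_fraisse_sequence.
move=> S bond fr; have [[obS _ _ _] _ _] := fr.
(* Replacing the whole family of objects at once turns [bond] into maps of [natbar], without
   transports. *)
have SE : S = fun=> (natbar : cuType) by apply/funext => i; exact: obS.
subst S; have [e [e_le e_unb bondE]] := fraisse_sequence_pow_bond p_prime fr.
exists (fun i => @Sp_embed R p (e i)).
apply: cu_limit_eq_bond (Sp_limit R p_prime e_le e_unb).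
by move=> i j /bondE ->.
Qed.
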